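(* Let $D\in\mathbb{C}^{n\times n}$ be a diagonal matrix with distinct diagonal entries $\lambda_1,\dots,\lambda_n$. Let $E\in\mathbb{C}^{n\times n}$ have zero diagonal, and let $B\in\mathbb{C}^{n\times n}$ be the matrix with zero diagonal such that $E=DB-BD$. Fix $i$, put $\eta_i=\min_{j\neq i}|\lambda_i-\lambda_j|$ and $\rho_i=\|E\|/\eta_i$, and let $t\in[0,1]$ satisfy $2t\rho_i<1$. Let $\lambda_i(t)$, $x_i(t)$, $\Delta(t)$, $r_i^{(0)}(t)$, $r_i^{(1)}(t)$, $r_i^{(2)}(t)$ be as defined in the context. Then $$\|r_i^{(0)}(t)\| \le \frac{t\|B(:,i)\|}{1-\frac{|\Delta(t)|+t\|E\|}{\eta_i}} \le \frac{t\rho_i}{1-2t\rho_i},$$ $$\|r_i^{(1)}(t)\| \le \frac{t\,(|\Delta(t)|+t\|E\|)\,\|B(:,i)\|}{\eta_i\left(1-\frac{|\Delta(t)|+t\|E\|}{\eta_i}\right)} \le \frac{2(t\rho_i)^2}{1-2t\rho_i},$$ $$\|r_i^{(2)}(t)\| \le \left(|\Delta(t)|\frac{t\|B(:,i)\|}{\eta_i}+\frac{t^2\left(|\Delta(t)|\,\|E\|+t\|E\|^2\right)\|B(:,i)\|}{\eta_i^2}\right)\frac{1}{1-\frac{2t\|E\|}{\eta_i}} \le \left(t\,\frac{|\Delta(t)|}{\eta_i}\,\rho_i+2(t\rho_i)^3\right)\frac{1}{1-2t\rho_i}.$$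
   Context: $\|\cdot\|$ is the spectral norm for matrices and the Euclidean norm for vectors; $M(:,i)$ denotes the $i$-th column of a matrix $M$; $e_i$ is the $i$-th canonical basis vector; $(\cdot)^\dagger$ is the Moore–Penrose pseudoinverse. For $i\ne j$ the matrix $B$ has entries $B(i,j)=E(i,j)/(\lambda_i-\lambda_j)$. $\lambda_i(t)$ denotes the eigenvalue of $D+tE$ that is the perturbation (continuous in $t$) of $\lambda_i=\lambda_i(0)$, and $x_i(t)$ is the right eigenvector of $D+tE$ associated with $\lambda_i(t)$, normalized so that its $i$-th entry equals $1$. Set $\Delta(t)=\lambda_i(t)-\lambda_i$ and $$x_i^{(0)}=e_i,\qquad x_i^{(1)}=-B(:,i),\qquad x_i^{(2)}=(D-\lambda_iI)^{\dagger}E\,B(:,i),$$ $$r_i^{(0)}(t)=x_i(t)-x_i^{(0)},\quad r_i^{(1)}(t)=x_i(t)-x_i^{(0)}-t\,x_i^{(1)},\quad r_i^{(2)}(t)=x_i(t)-x_i^{(0)}-t\,x_i^{(1)}-t^2x_i^{(2)}.$$ *)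

(* Defs.v *)
From HB Require Import structures.
From mathcomp Require Import all_boot all_order all_algebra.
From mathcomp Require Import sesquilinear spectral.
From mathcomp Require Import complex.
From mathcomp Require Import all_classical all_reals all_analysis.
Set Implicit Arguments.
Unset Strict Implicit.
Unset Printing Implicit Defensive.
Import Order.TTheory GRing.Theory Num.Theory.
Import numFieldNormedType.Exports.

Local Open Scope classical_set_scope.
Local Open Scope complex_scope.
Local Open Scope sesquilinear_scope.
Local Open Scope ring_scope.

(* The modulus as an element of R: on R[i], `|z| lives in R[i]. *)
Definition cabs (R : realType) (z : R[i]) : R := Normc.normc z.

Definition enorm (R : realType) (n : nat) (v : 'cV[R[i]]_n) : R :=
  Num.sqrt (\sum_(j < n) cabs (v j 0) ^+ 2).

Definition specnorm (R : realType) (m n : nat) (A : 'M[R[i]]_(m, n)) : R :=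
  sup [set enorm (A *m v) | v in [set v : 'cV[R[i]]_n | enorm v <= 1]].

(* The four Penrose equations. *)
Definition is_mpinv (R : realType) (m n : nat)
    (A : 'M[R[i]]_(m, n)) (X : 'M[R[i]]_(n, m)) : Prop :=
  [/\ A *m X *m A = A,
      X *m A *m X = X,
      (A *m X)^t* = A *m X
    & (X *m A)^t* = X *m A].

(* The Moore-Penrose pseudoinverse; MathComp's pinvmx is only a one-sided
   partial inverse that need not satisfy the Penrose equations. *)
Definition mpinv (R : realType) (m n : nat) (A : 'M[R[i]]_(m, n)) :
    'M[R[i]]_(n, m) :=
  xget 0 [set X | is_mpinv A X].

(* Minimum over j != i; the infimum is attained as soon as 1 < n.  For n = 1
   the index set is empty and inf set0 = 0, so that rho_gap D E i = 0. *)
Definition eta_gap (R : realType) (n : nat) (D : 'M[R[i]]_n) (i : 'I_n) : R :=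
  inf [set cabs (D i i - D j j) | j in [set j : 'I_n | j != i]].

Definition rho_gap (R : realType) (n : nat) (D E : 'M[R[i]]_n) (i : 'I_n) : R :=
  specnorm E / eta_gap D i.

(* lam follows, continuously on [0, t], the eigenvalue of D + s E that starts
   at D i i. The regular algebra R[i]^o carries the usual topology of the
   complex plane. *)
Definition is_perturbed_eigenvalue (R : realType) (n : nat)
    (D E : 'M[R[i]]_n) (i : 'I_n) (t : R) (lam : R -> R[i]) : Prop :=
  [/\ lam 0 = D i i,
      {within `[0, t], continuous (lam : R -> R[i]^o)}
    & forall s, 0 <= s <= t -> eigenvalue (D + s%:C *: E) (lam s)].

(* MathComp's eigenspaces consist of row vectors, hence the explicit
   right eigenvector equation. *)
Definition is_normalized_eigenvector (R : realType) (n : nat)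
    (A : 'M[R[i]]_n) (i : 'I_n) (mu : R[i]) (v : 'cV[R[i]]_n) : Prop :=
  A *m v = mu *: v /\ v i 0 = 1.

Definition xord0 (R : realType) (n : nat) (i : 'I_n) : 'cV[R[i]]_n :=
  delta_mx i 0.

Definition xord1 (R : realType) (n : nat) (B : 'M[R[i]]_n) (i : 'I_n) :
    'cV[R[i]]_n :=
  - col i B.

Definition xord2 (R : realType) (n : nat) (D E B : 'M[R[i]]_n) (i : 'I_n) :
    'cV[R[i]]_n :=
  mpinv (D - (D i i)%:M) *m E *m col i B.

Definition res0 (R : realType) (n : nat) (i : 'I_n)
    (x : R -> 'cV[R[i]]_n) (t : R) : 'cV[R[i]]_n :=
  x t - xord0 R i.

Definition res1 (R : realType) (n : nat) (B : 'M[R[i]]_n) (i : 'I_n)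
    (x : R -> 'cV[R[i]]_n) (t : R) : 'cV[R[i]]_n :=
  x t - xord0 R i - t%:C *: xord1 B i.

Definition res2 (R : realType) (n : nat) (D E B : 'M[R[i]]_n) (i : 'I_n)
    (x : R -> 'cV[R[i]]_n) (t : R) : 'cV[R[i]]_n :=
  x t - xord0 R i - t%:C *: xord1 B i - (t ^+ 2)%:C *: xord2 D E B i.

Definition Delta (R : realType) (n : nat) (D : 'M[R[i]]_n) (i : 'I_n)
    (lam : R -> R[i]) (t : R) : R[i] :=
  lam t - D i i.

(* Main.v *)
Require Import Defs.
From HB Require Import structures.
From mathcomp Require Import all_boot all_order all_algebra.
From mathcomp Require Import ring lra.
From mathcomp Require Import sesquilinear spectral.
From mathcomp Require Import complex.
From mathcomp Require Import all_classical all_reals all_analysis.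
Import Order.TTheory GRing.Theory Num.Theory.
Set Implicit Arguments.
Unset Strict Implicit.
Unset Printing Implicit Defensive.
Import numFieldNormedType.Exports.

Local Open Scope complex_scope.
Local Open Scope ring_scope.

(* Let S be the pseudoinverse of D - lambda_i, so |S| <= 1 / eta_i.  In these
   terms B(:,i) = S E e_i, and the eigenvector equation becomes the fixed-point
   identity r0 = - t B(:,i) + S (Delta - t E) r0, while
   r1 = S (Delta - t E) r0 and r2 = S (Delta r0 - t E r1).
   Taking norms gives the left-hand inequalities.  The right-hand ones then
   follow from |B(:,i)| <= rho_i and |Delta(t)| <= t |E|.  The latter is a
   Bauer-Fike bound transported along the continuous branch: the disks around
   the other eigenvalues are disjoint from the one around lambda_i. *)

(** * The real-valued modulus on the complex numbers *)

Section Modulus.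
Variable R : realType.
Implicit Types (z w : R[i]) (a : R).

Lemma cabs0 : cabs (0 : R[i]) = 0.
Proof. exact: Normc.normc0. Qed.

Lemma cabs_norm z : (cabs z)%:C = `|z|.
Proof. by []. Qed.

Lemma cabs_ge0 z : 0 <= cabs z.
Proof. by rewrite -lecR cabs_norm normr_ge0. Qed.

Lemma cabs_eq0 z : cabs z = 0 -> z = 0.
Proof. exact: Normc.eq0_normc. Qed.

Lemma cabsM z w : cabs (z * w) = cabs z * cabs w.
Proof. exact: Normc.normcM. Qed.

Lemma cabsV z : cabs z^-1 = (cabs z)^-1.
Proof. exact: Normc.normcV. Qed.

Lemma cabsN z : cabs (- z) = cabs z.
Proof. exact: normcN. Qed.

Lemma cabsD z w : cabs (z + w) <= cabs z + cabs w.
Proof. exact: le_normcD. Qed.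

Lemma cabs_real a : 0 <= a -> cabs a%:C = a.
Proof. by move=> a0; rewrite /cabs /= expr0n addr0 sqrtr_sqr ger0_norm. Qed.

Lemma cabsB_distl z w : `|cabs z - cabs w| <= cabs (z - w).
Proof.
have h1 := cabsD (z - w) w; have h2 := cabsD (w - z) z.
rewrite !subrK in h1 h2; rewrite -(cabsN (w - z)) opprB in h2.
by rewrite ler_norml; apply/andP; split; lra.
Qed.

Lemma cabs_sum (I : finType) (F : I -> R[i]) :
  cabs (\sum_j F j) <= \sum_j cabs (F j).
Proof.
elim/big_ind2: _ => [|a z b w az bw|//]; first by rewrite cabs0.
by apply: le_trans (cabsD _ _) _; apply: lerD.
Qed.

(** By [cabsB_distl] the modulus is 1-Lipschitz, so the complex ball of radius [e%:C] around [z] is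
    the required neighbourhood. *)
Lemma continuous_cabs : continuous (@cabs R : R[i]^o -> R).
Proof.
move=> z; have FF := nbhs_filter (z : R[i]^o).
apply/(@cvgrPdist_lt R R _ _ FF) => /= e e0.
have ec : 0 < e%:C :> R[i] by rewrite ltcR.
apply: (filterS _ (nbhsx_ballx (z : R[i]^o) e%:C ec)) => w.
rewrite -ball_normE /= => zw.
apply: le_lt_trans (cabsB_distl _ _) _.
by rewrite -ltcR cabs_norm.
Qed.

End Modulus.

(** * The Euclidean norm and entrywise comparison *)

Section EuclideanNorm.
Variable R : realType.

(** Expanding the sum of the squares of [A * b j - C * a j] gives [A * (A * B - C ^+ 2)]; dividing
    by [A] concludes unless [A = 0], where every [a j] vanishes. *)
Lemma cauchy_schwarz_sum (n : nat) (a b : 'I_n -> R) :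
  (\sum_j a j * b j) ^+ 2 <= (\sum_j a j ^+ 2) * (\sum_j b j ^+ 2).
Proof.
set A := \sum_j a j ^+ 2; set B := \sum_j b j ^+ 2; set C := \sum_j a j * b j.
have A0 : 0 <= A by apply: sumr_ge0 => j _; apply: sqr_ge0.
have key : \sum_j (A * b j - C * a j) ^+ 2 = A * (A * B - C ^+ 2).
  transitivity (\sum_j (A ^+ 2 * b j ^+ 2 - 2 * A * C * (a j * b j)
                        + C ^+ 2 * a j ^+ 2)).
    by apply: eq_bigr => j _; ring.
  by rewrite big_split sumrB /= -!mulr_sumr -/A -/B -/C; ring.
have [A00|A00] := eqVneq A 0; last first.
  have Ap : 0 < A by rewrite lt_def A00.
  rewrite -subr_ge0 -(pmulr_rge0 _ Ap) -key.
  by apply: sumr_ge0 => j _; apply: sqr_ge0.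
have C0 : C = 0.
  apply: big1 => j _; move/eqP: A00.
  rewrite psumr_eq0 => [/allP /(_ j (mem_index_enum j))|k _]; last exact: sqr_ge0.
  by rewrite sqrf_eq0 => /eqP ->; rewrite mul0r.
by rewrite C0 A00 expr0n mul0r.
Qed.

Variable n : nat.
Implicit Types (u v : 'cV[R[i]]_n) (c : R) (z : R[i]).

Lemma enorm_ge0 v : 0 <= enorm v.
Proof. exact: sqrtr_ge0. Qed.

Lemma sqr_enorm v : enorm v ^+ 2 = \sum_(j < n) cabs (v j 0) ^+ 2.
Proof. by rewrite sqr_sqrtr // sumr_ge0 // => j _; apply: sqr_ge0. Qed.

Lemma enorm_le u c :
  0 <= c -> \sum_(j < n) cabs (u j 0) ^+ 2 <= c ^+ 2 -> enorm u <= c.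
Proof. by move=> c0 h; rewrite -(ler_pXn2r (n:=2)) ?nnegrE ?enorm_ge0 ?sqr_enorm. Qed.

Lemma cabs_le_enorm v j : cabs (v j 0) <= enorm v.
Proof.
rewrite -(ler_pXn2r (n:=2)) ?nnegrE ?enorm_ge0 ?cabs_ge0 // sqr_enorm.
by rewrite (bigD1 j) //= lerDl sumr_ge0 // => k _; apply: sqr_ge0.
Qed.

Lemma enorm_eq0 v : enorm v = 0 -> v = 0.
Proof.
move=> v0; apply/colP => j; rewrite mxE; apply: cabs_eq0; apply/eqP.
by rewrite eq_le cabs_ge0 andbT -v0 cabs_le_enorm.
Qed.

Lemma enorm0 : enorm (0 : 'cV[R[i]]_n) = 0.
Proof. by rewrite /enorm big1 ?sqrtr0 // => j _; rewrite mxE cabs0 expr0n. Qed.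

Lemma enormZ z v : enorm (z *: v) = cabs z * enorm v.
Proof.
have z0 := cabs_ge0 z.
apply/eqP; rewrite -(eqrXn2 (n:=2)) ?mulr_ge0 ?enorm_ge0 //.
rewrite exprMn !sqr_enorm mulr_sumr; apply/eqP/eq_bigr => j _.
by rewrite mxE cabsM exprMn.
Qed.

Lemma enormN v : enorm (- v) = enorm v.
Proof. by rewrite -scaleN1r enormZ cabsN [cabs 1]Normc.normc1 mul1r. Qed.

Lemma enormD u v : enorm (u + v) <= enorm u + enorm v.
Proof.
apply: enorm_le; first by rewrite addr_ge0 ?enorm_ge0.
have h : \sum_(j < n) cabs (u j 0) * cabs (v j 0) <= enorm u * enorm v.
  rewrite -(ler_pXn2r (n:=2)) ?nnegrE ?mulr_ge0 ?enorm_ge0 //; last first.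
    by rewrite sumr_ge0 // => j _; rewrite mulr_ge0 ?cabs_ge0.
  by rewrite exprMn !sqr_enorm; apply: cauchy_schwarz_sum.
have -> : (enorm u + enorm v) ^+ 2
    = enorm u ^+ 2 + 2 * (enorm u * enorm v) + enorm v ^+ 2 by ring.
apply: (@le_trans _ _ (\sum_(j < n) (cabs (u j 0) ^+ 2
   + 2 * (cabs (u j 0) * cabs (v j 0)) + cabs (v j 0) ^+ 2))).
  apply: ler_sum => j _; rewrite mxE.
  have -> : cabs (u j 0) ^+ 2 + 2 * (cabs (u j 0) * cabs (v j 0))
    + cabs (v j 0) ^+ 2 = (cabs (u j 0) + cabs (v j 0)) ^+ 2 by ring.
  by rewrite ler_pXn2r ?nnegrE ?addr_ge0 ?cabs_ge0 ?cabsD.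
by rewrite !big_split -mulr_sumr /= -!sqr_enorm lerD2r lerD2l ler_pM2l.
Qed.

Lemma enormB u v : enorm (u - v) <= enorm u + enorm v.
Proof. by apply: le_trans (enormD _ _) _; rewrite enormN. Qed.

Lemma enorm_entry_le u v c : 0 <= c ->
  (forall j, cabs (u j 0) <= c * cabs (v j 0)) -> enorm u <= c * enorm v.
Proof.
move=> c0 h; apply: enorm_le; first by rewrite mulr_ge0 ?enorm_ge0.
rewrite exprMn sqr_enorm mulr_sumr; apply: ler_sum => j _.
by rewrite -exprMn ler_pXn2r ?nnegrE ?mulr_ge0 ?cabs_ge0.
Qed.

(** At a zero entry of [v] both sides may vanish, so strictness is asked only elsewhere; one nonzero
    entry makes the whole sum of squares strictly larger. *)
Lemma enorm_entry_lt u v c : 0 <= c -> v != 0 ->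
  (forall j, v j 0 != 0 -> c * cabs (v j 0) < cabs (u j 0)) ->
  c * enorm v < enorm u.
Proof.
move=> c0 v0 h; rewrite -(ltr_pXn2r (n:=2)) ?nnegrE ?mulr_ge0 ?enorm_ge0 //.
rewrite exprMn !sqr_enorm mulr_sumr.
have [k vk] : exists k, v k 0 != 0.
  apply/existsP; apply: contraNT v0; rewrite negb_exists => /forallP v0.
  by apply/eqP/colP => j; rewrite mxE; apply/eqP; move: (v0 j); rewrite negbK.
rewrite (bigD1 k) // [ltRHS](bigD1 k) //=; apply: ltr_leD.
  by rewrite -exprMn ltr_pXn2r ?nnegrE ?mulr_ge0 ?cabs_ge0 ?h.
apply: ler_sum => j _; rewrite -exprMn.
have [->|vj] := eqVneq (v j 0) 0.
  by rewrite cabs0 mulr0 expr0n sqr_ge0.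
by rewrite ler_pXn2r ?nnegrE ?mulr_ge0 ?cabs_ge0 // ltW // h.
Qed.

Lemma enorm_delta (i : 'I_n) : enorm (delta_mx i 0 : 'cV[R[i]]_n) = 1.
Proof.
rewrite /enorm (bigD1 i) //= mxE !eqxx big1 => [|j ji].
  by rewrite [cabs _]Normc.normc1 expr1n addr0 sqrtr1.
by rewrite mxE (negPf ji) cabs0 expr0n.
Qed.

End EuclideanNorm.

(** * The spectral norm as an attained-or-approached operator bound *)

Section SpectralNorm.
Variables (R : realType) (m n : nat) (A : 'M[R[i]]_(m, n)).

(** A crude constant, the sum of the moduli of all entries, is enough: it makes the supremum in
    [specnorm] one of a bounded set. *)
Lemma enorm_mulmx_bounded :
  exists2 c : R, 0 <= c & forall v, enorm (A *m v) <= c * enorm v.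
Proof.
pose s j := \sum_k cabs (A j k).
have s0 j : 0 <= s j by apply: sumr_ge0 => k _; apply: cabs_ge0.
exists (\sum_j s j) => [|v]; first exact: sumr_ge0.
apply: enorm_le; first by rewrite mulr_ge0 ?enorm_ge0 ?sumr_ge0.
rewrite exprMn.
apply: (@le_trans _ _ (\sum_j s j ^+ 2 * enorm v ^+ 2)).
  apply: ler_sum => j _; rewrite -exprMn.
  rewrite ler_pXn2r ?nnegrE ?mulr_ge0 ?cabs_ge0 ?enorm_ge0 //.
  rewrite mxE; apply: le_trans (cabs_sum _) _; rewrite mulr_suml.
  by apply: ler_sum => k _; rewrite cabsM ler_wpM2l ?cabs_ge0 ?cabs_le_enorm.
rewrite -mulr_suml ler_wpM2r ?sqr_ge0 //.
(* Each row sum [s j] is at most the total of the nonnegative row sums. *)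
rewrite expr2 mulr_suml; apply: ler_sum => j _.
rewrite expr2 ler_wpM2l //.
by rewrite (bigD1 j) //= lerDl sumr_ge0.
Qed.

Lemma specnorm_has_ubound :
  has_ubound [set enorm (A *m v) | v in [set v : 'cV[R[i]]_n | enorm v <= 1]]%classic.
Proof.
have [c c0 h] := enorm_mulmx_bounded; exists c => _ [v /= v1 <-].
by apply: le_trans (h v) _; rewrite -[leRHS]mulr1 ler_wpM2l.
Qed.

Lemma specnorm_ge0 : 0 <= specnorm A.
Proof.
apply: (ub_le_sup specnorm_has_ubound); exists 0; last by rewrite mulmx0 enorm0.
by rewrite /= enorm0 ler01.
Qed.

(** A nonzero [v] is rescaled to unit norm, where it competes in the supremum. *)
Lemma enorm_mulmx v : enorm (A *m v) <= specnorm A * enorm v.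
Proof.
have [v0|v0] := eqVneq (enorm v) 0.
  by rewrite (enorm_eq0 v0) mulmx0 !enorm0 mulr0.
have vp : 0 < enorm v by rewrite lt_def v0 enorm_ge0.
have iv0 : 0 <= (enorm v)^-1 by rewrite invr_ge0 ltW.
rewrite -ler_pdivrMr // mulrC -[X in X * _]cabs_real // -enormZ scalemxAr.
apply: (ub_le_sup specnorm_has_ubound); exists ((enorm v)^-1%:C *: v) => //.
by rewrite /= enormZ cabs_real // mulVf.
Qed.

End SpectralNorm.

Lemma enorm_col (R : realType) (m n : nat) (A : 'M[R[i]]_(m, n)) (k : 'I_n) :
  enorm (col k A) <= specnorm A.
Proof.
rewrite colE; apply: le_trans (enorm_mulmx _ _) _.
by rewrite enorm_delta mulr1.
Qed.

(** * Uniqueness of the pseudoinverse and its diagonal case *)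

Section Pseudoinverse.
Variable R : realType.
Local Open Scope sesquilinear_scope.

(** Replacing [A] by [A Y A] inside the self-adjoint [A X] and reversing the product gives
    [A X = A X A Y = A Y]; likewise [X A = Y A]. Hence [X = X A X = X A Y = Y A Y = Y]. *)
Lemma is_mpinv_unique (m n : nat) (A : 'M[R[i]]_(m, n)) (X Y : 'M[R[i]]_(n, m)) :
  is_mpinv A X -> is_mpinv A Y -> X = Y.
Proof.
have adjM (p q r : nat) (U : 'M[R[i]]_(p, q)) (V : 'M[R[i]]_(q, r)) :
    (U *m V)^t* = V^t* *m U^t* by rewrite trmx_mul map_mxM.
move=> [x1 x2 x3 x4] [y1 y2 y3 y4].
have hl : A *m X = A *m Y.
  by rewrite -x3 -{1}y1 -mulmxA adjM x3 y3 mulmxA x1.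
have hr : X *m A = Y *m A.
  by rewrite -x4 -{1}y1 !mulmxA -(mulmxA _ Y) adjM x4 y4 -mulmxA (mulmxA A) x1.
by rewrite -x2 -mulmxA hl mulmxA hr y2.
Qed.

(** Entrywise inversion, with [0^-1 = 0], satisfies the Penrose equations, and uniqueness identifies
    it with the matrix chosen by [xget]. *)
Lemma mpinv_diag_mx (n : nat) (d : 'rV[R[i]]_n) :
  mpinv (diag_mx d) = diag_mx (\row_j (d 0 j)^-1).
Proof.
have hinv : is_mpinv (diag_mx d) (diag_mx (\row_j (d 0 j)^-1)).
  rewrite /is_mpinv !mulmx_diag !tr_diag_mx !map_diag_mx.
  split; congr diag_mx; apply/rowP => j; rewrite !mxE;
    have [->|dj] := eqVneq (d 0 j) 0;
    by rewrite ?invr0 ?mulr0 ?mul0r ?mulfV ?mulVf ?mul1r ?rmorph0 ?rmorph1.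
rewrite /mpinv; case: xgetP => [X _ hX|/(_ _ hinv)//].
exact: is_mpinv_unique hX hinv.
Qed.

End Pseudoinverse.

(** * Bauer-Fike bound, spectral gap and localization of the branch *)

Section EigenvalueLocalization.
Variables (R : realType) (n : nat).
Implicit Types (A D E F : 'M[R[i]]_n) (mu : R[i]).

(** Left and right eigenvalues agree because a matrix and its transpose have the same
    determinant. *)
Lemma eigenvalue_right A mu :
  eigenvalue A mu -> exists2 v : 'cV[R[i]]_n, A *m v = mu *: v & v != 0.
Proof.
case/eigenvalueP => u uA u0.
have /det0P [w w0 wA] : \det (A - mu%:M)^T == 0.
  rewrite det_tr; apply/det0P; exists u => //.
  by rewrite mulmxBr uA mul_mx_scalar subrr.
exists w^T; last by rewrite trmx_eq0.
apply/eqP; rewrite -subr_eq0 -mul_scalar_mx -mulmxBl -trmx_eq0 trmx_mul trmxK.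
by rewrite wA.
Qed.

(** If every diagonal entry were farther than [specnorm F] from [mu], then [D - mu] would stretch an
    eigenvector [v] by more than [specnorm F], whereas [(D - mu) v = - F v]. *)
Lemma bauer_fike_diag D F mu :
  is_diag_mx D -> eigenvalue (D + F) mu ->
  exists j, cabs (D j j - mu) <= specnorm F.
Proof.
move=> /diag_mxP [d ->] /eigenvalue_right [v vF v0].
apply/existsP; apply: contraT; rewrite negb_exists => /forallP h.
have : specnorm F * enorm v < enorm ((diag_mx d - mu%:M) *m v).
  apply: enorm_entry_lt => //; first exact: specnorm_ge0.
  move=> j vj; move: (h j); rewrite -ltNge mxE eqxx mulr1n => hj.
  rewrite mulmxBl mul_scalar_mx mul_diag_mx !mxE -mulrBl cabsM.
  rewrite ltr_pM2r // lt_def cabs_ge0 andbT.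
  by apply: contraNneq vj => /cabs_eq0 ->.
have -> : (diag_mx d - mu%:M) *m v = - (F *m v).
  by rewrite mulmxBl mul_scalar_mx -vF mulmxDl opprD addrA subrr add0r.
by rewrite enormN ltNge enorm_mulmx.
Qed.

Lemma specnormZ_le (a : R[i]) F : specnorm (a *: F) <= cabs a * specnorm F.
Proof.
apply: ge_sup.
  by exists (enorm ((a *: F) *m (0 : 'cV[R[i]]_n))), 0 => //=; rewrite enorm0 ler01.
move=> _ [v /= v1 <-]; rewrite -scalemxAl enormZ ler_wpM2l ?cabs_ge0 //.
apply: le_trans (enorm_mulmx _ _) _.
by rewrite -[leRHS]mulr1 ler_wpM2l ?specnorm_ge0.
Qed.

Lemma eta_gap_le D i j : j != i -> eta_gap D i <= cabs (D i i - D j j).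
Proof.
move=> ji; apply: ge_inf; last by exists j.
by exists 0 => _ [k _ <-]; exact: cabs_ge0.
Qed.

(** The index [j] makes the finite index set nonempty, so the infimum is bounded below by a minimum,
    nonzero by distinctness. *)
Lemma eta_gap_gt0 D i j :
  injective (fun k => D k k) -> j != i -> 0 < eta_gap D i.
Proof.
move=> Dinj ji; pose g k := cabs (D i i - D k k).
have [k ki kmin] := arg_minP g (P := fun k => k != i) ji.
apply: (@lt_le_trans _ _ (g k)).
  rewrite lt_def cabs_ge0 andbT; apply: contra ki => /eqP/cabs_eq0/eqP.
  by rewrite subr_eq0 => /eqP/Dinj ->.
apply: lb_le_inf; first by exists (g j), j.
by move=> _ [l /= li <-]; exact: kmin.
Qed.

Lemma eta_gap_ge0 D i : injective (fun k => D k k) -> 0 <= eta_gap D i.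
Proof.
move=> Dinj; have [[j ji]|h] := pselect (exists j, j != i).
  exact/ltW/(eta_gap_gt0 Dinj ji).
rewrite /eta_gap (_ : mkset _ = set0) ?image_set0 ?inf0 //.
by apply/seteqP; split => // j ji; apply: h; exists j.
Qed.

(* The Bauer-Fike disks of radius [t * specnorm E] around [D i i] and around
   the other diagonal entries are disjoint, so that by the intermediate value
   theorem the continuous branch [lam] cannot leave the former. *)
Lemma Delta_le D E i t lam :
  is_diag_mx D -> 0 <= t -> 2 * (t * specnorm E) < eta_gap D i ->
  is_perturbed_eigenvalue D E i t lam ->
  cabs (Delta D i lam t) <= t * specnorm E.
Proof.
move=> Ddiag t0 small [lam0 lamc lamE]; rewrite leNgt; apply/negP => far.
have N0 := specnorm_ge0 E.
pose f s := cabs (lam s - D i i).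
have gc : continuous ((fun z => cabs (z - D i i)) : R[i]^o -> R).
  move=> z.
  apply: (@continuous_comp R[i]^o R[i]^o R (fun z => z - D i i) (@cabs R)).
    apply: (@cvgB _ R[i]^o _ (nbhs (z : R[i]^o)) _ id (fun=> D i i)).
    - exact: cvg_id.
    - exact: cvg_cst.
  exact: continuous_cabs.
have fc : {within `[0, t], continuous f}%classic.
  move=> s; have lams := lamc s; have gs := gc (lam s).
  exact: (@continuous_comp (subspace `[0, t]%classic) R[i]^o R lam _ s lams gs).
have f0 : f 0 = 0 by rewrite /f lam0 subrr cabs0.
(* A level above the disk radius, so outside the disk around [D i i], yet at most half the gap, and
   reached by [f] because it is at most [f t]. *)
pose c := Num.min (f t) (eta_gap D i / 2).
have ct : t * specnorm E < c by rewrite lt_min far /=; lra.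
have ceta : c <= eta_gap D i / 2 by rewrite ge_min lexx orbT.
have cft : c <= f t by rewrite ge_min lexx.
have tN0 : 0 <= t * specnorm E by rewrite mulr_ge0.
have [|s st fs] := IVT t0 fc (v := c).
  by rewrite f0 ge_min le_max cft orbT andbT; apply/orP; left; lra.
move: st; rewrite in_itv /= => st; have /andP[s0 s1] := st.
have [j hj] := bauer_fike_diag Ddiag (lamE s st).
have {}hj : cabs (D j j - lam s) <= t * specnorm E.
  apply: le_trans hj _; apply: le_trans (specnormZ_le _ _) _.
  by rewrite cabs_real // ler_wpM2r.
(* For [j = i] the level [c] would be at most the radius; otherwise the gap would be at most [c]
   plus the radius, whose sum is below it. *)
have [ji|ji] := eqVneq j i.
  by move: hj; rewrite ji -cabsN opprB -/(f s) fs; lra.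
have := eta_gap_le D ji; have := cabsD (D i i - lam s) (lam s - D j j).
rewrite addrA subrK -(cabsN (D i i - _)) opprB -/(f s) fs.
by rewrite -(cabsN (lam s - _)) opprB; lra.
Qed.

End EigenvalueLocalization.

(** * The reduced resolvent at [D i i] and its norm *)

Section ReducedResolvent.
Variables (R : realType) (n : nat) (D : 'M[R[i]]_n) (i : 'I_n).
Hypothesis Ddiag : is_diag_mx D.
Local Notation S := (mpinv (D - (D i i)%:M)).

(* For [j = i] the right-hand side is [0] because [0^-1 = 0]. *)
Lemma reduced_resolventE (v : 'cV[R[i]]_n) j :
  (S *m v) j 0 = (D j j - D i i)^-1 * v j 0.
Proof.
have /diag_mxP [d dE] := Ddiag.
have -> : D - (D i i)%:M = diag_mx (d - const_mx (D i i)).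
  by rewrite raddfB /= diag_const_mx -dE.
by rewrite mpinv_diag_mx mul_diag_mx !mxE {2}dE mxE eqxx mulr1n.
Qed.

Lemma enorm_reduced_resolvent (v : 'cV[R[i]]_n) :
  injective (fun j => D j j) -> enorm (S *m v) <= enorm v / eta_gap D i.
Proof.
move=> Dinj; have eta0 := eta_gap_ge0 i Dinj.
rewrite mulrC; apply: enorm_entry_le => [|j]; first by rewrite invr_ge0.
rewrite reduced_resolventE cabsM ler_wpM2r ?cabs_ge0 //.
(* The multiplier at [i] is [0]; an index [j != i] is what makes the gap positive, so that inverses
   can be compared. *)
have [->|ji] := eqVneq j i; first by rewrite subrr invr0 cabs0 invr_ge0.
have etap := eta_gap_gt0 Dinj ji.
rewrite cabsV -cabsN opprB lef_pV2 ?posrE ?eta_gap_le //.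
exact: lt_le_trans etap (eta_gap_le D ji).
Qed.

End ReducedResolvent.

(** * Fixed-point identities and recursive bounds for the residuals *)

Section Residuals.
Variables (R : realType) (n : nat) (D E B : 'M[R[i]]_n).
Hypotheses (Ddiag : is_diag_mx D) (Dinj : injective (fun j => D j j)).
Hypotheses (Bdiag : forall j, B j j = 0) (EB : E = D *m B - B *m D).
Variables (i : 'I_n) (t : R) (lam : R -> R[i]) (x : R -> 'cV[R[i]]_n).
Hypothesis t0 : 0 <= t.
Hypothesis xE : is_normalized_eigenvector (D + t%:C *: E) i (lam t) (x t).
Local Notation S := (mpinv (D - (D i i)%:M)).
Local Notation delta := (Delta D i lam t).

(** Off the diagonal [E j i = (D j j - D i i) * B j i], a factor that [S] inverts; at [i] the zero
    of [S] matches [B i i = 0]. *)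
Lemma col_commutator : col i B = S *m col i E.
Proof.
have /diag_mxP [d dE] := Ddiag.
have djj k : D k k = d 0 k by rewrite dE mxE eqxx.
apply/colP => j; rewrite reduced_resolventE // [LHS]mxE [col i E j 0]mxE.
have -> : E j i = (D j j - D i i) * B j i.
  by rewrite EB !djj dE mul_diag_mx mul_mx_diag !mxE; ring.
have [->|ji] := eqVneq j i; first by rewrite Bdiag !mulr0.
by rewrite mulKf // subr_eq0; apply: contra ji => /eqP/Dinj ->.
Qed.

(** Row [j] of the eigenvector equation turns the bracket into [(D j j - D i i) * x t j 0] for
    [j != i], which [S] inverts. At [j = i] the normalization makes the residual vanish, as [S]
    does. *)
Lemma res0_fixpoint :
  res0 i x t = S *m (delta *: res0 i x t - t%:C *: (E *m x t)).
Proof.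
have [xeq xi] := xE; have /diag_mxP [d dE] := Ddiag.
have djj k : D k k = d 0 k by rewrite dE mxE eqxx.
apply/colP => j; rewrite reduced_resolventE //.
have xj : D j j * x t j 0 + t%:C * (E *m x t) j 0 = lam t * x t j 0.
  have := congr1 (fun M : 'cV_n => M j 0) xeq.
  by rewrite djj dE mulmxDl -scalemxAl mul_diag_mx !mxE.
have -> : (delta *: res0 i x t - t%:C *: (E *m x t)) j 0
    = delta * res0 i x t j 0 - (lam t - D j j) * x t j 0.
  have entryE (a b : R[i]) (u v : 'cV[R[i]]_n) :
      (a *: u - b *: v) j 0 = a * u j 0 - b * v j 0 by rewrite !mxE.
  by rewrite entryE (mulrBl (x t j 0) (lam t)) -xj; ring.
have [->|ji] := eqVneq j i.
  by rewrite subrr invr0 mul0r /res0 /xord0 !mxE xi !eqxx subrr.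
have -> : res0 i x t j 0 = x t j 0.
  by rewrite /res0 /xord0 !mxE (negPf ji) subr0.
have -> : delta * x t j 0 - (lam t - D j j) * x t j 0
    = (D j j - D i i) * x t j 0 by rewrite /Delta; ring.
by rewrite mulKf // subr_eq0; apply: contra ji => /eqP/Dinj ->.
Qed.

Lemma mulmx_res0 : E *m x t = E *m res0 i x t + col i E.
Proof. by rewrite /res0 /xord0 mulmxBr -colE subrK. Qed.

Lemma res1E : res1 B i x t = res0 i x t + t%:C *: col i B.
Proof. by rewrite /res1 /xord1 scalerN opprK. Qed.

(** Splitting [x t] into [res0] and the basis vector produces [t S E e_i], which cancels the
    first-order term. *)
Lemma res1_fixpoint :
  res1 B i x t = S *m (delta *: res0 i x t - t%:C *: (E *m res0 i x t)).
Proof.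
rewrite res1E col_commutator scalemxAr.
rewrite {1}res0_fixpoint -mulmxDr mulmx_res0 (scalerDr t%:C) opprD addrA.
by rewrite subrK.
Qed.

(** The second-order term is [t ^+ 2] times [S E B(:,i)]; it merges with [t S E res0] since [res1]
    is [res0] plus [t B(:,i)]. *)
Lemma res2_fixpoint :
  res2 D E B i x t = S *m (delta *: res0 i x t - t%:C *: (E *m res1 B i x t)).
Proof.
rewrite /res2 /xord2 -/(res1 B i x t) {1}res1_fixpoint -(mulmxA S).
rewrite (scalemxAr (t ^+ 2)%:C) -mulmxBr -addrA -opprD.
congr (_ *m (_ - _)).
rewrite res1E (mulmxDr E (res0 i x t)) (scalerDr t%:C) -(scalemxAr t%:C).
by rewrite scalerA expr2 rmorphM.
Qed.

(** Two separate vectors serve both identities: [u] and [v] are both [res0] for [res1], but [res0]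
    and [res1] for [res2]. *)
Lemma enorm_reduced_resolventB (u v : 'cV[R[i]]_n) :
  enorm (S *m (delta *: u - t%:C *: (E *m v)))
    <= (cabs delta * enorm u + t * specnorm E * enorm v) / eta_gap D i.
Proof.
apply: le_trans (enorm_reduced_resolvent _ _ _ _) _ => //.
rewrite ler_wpM2r ?invr_ge0 ?eta_gap_ge0 //.
apply: le_trans (enormB _ _) _; rewrite !enormZ cabs_real // -mulrA.
by rewrite lerD2l ler_wpM2l ?enorm_mulmx.
Qed.

Lemma enorm_col_commutator : enorm (col i B) <= specnorm E / eta_gap D i.
Proof.
rewrite col_commutator; apply: le_trans (enorm_reduced_resolvent _ _ _ _) _ => //.
by rewrite ler_wpM2r ?invr_ge0 ?eta_gap_ge0 ?enorm_col.
Qed.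

Lemma enorm_res1_le :
  enorm (res1 B i x t)
    <= (cabs delta + t * specnorm E) * enorm (res0 i x t) / eta_gap D i.
Proof.
rewrite res1_fixpoint; apply: le_trans (enorm_reduced_resolventB _ _) _.
by rewrite [(cabs delta + _) * _]mulrDl.
Qed.

Lemma enorm_res0_le :
  enorm (res0 i x t) <= t * enorm (col i B)
    + (cabs delta + t * specnorm E) * enorm (res0 i x t) / eta_gap D i.
Proof.
have {1}-> : res0 i x t = res1 B i x t - t%:C *: col i B.
  by rewrite res1E addrK.
apply: le_trans (enormB _ _) _; rewrite addrC enormZ cabs_real // lerD2l.
exact: enorm_res1_le.
Qed.

Lemma enorm_res2_le :
  enorm (res2 D E B i x t)
    <= (cabs delta * enorm (res0 i x t)
        + t * specnorm E * enorm (res1 B i x t)) / eta_gap D i.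
Proof. by rewrite res2_fixpoint; apply: enorm_reduced_resolventB. Qed.

End Residuals.

(** * Real arithmetic behind the three chains of bounds, and the conclusion *)

Lemma residual_bounds_arith (R : realType) (r0 r1 r2 b d N eta t : R) :
  0 <= t -> 0 <= b -> 0 <= d -> 0 <= N -> 0 <= eta -> 0 <= r0 ->
  2 * t * (N / eta) < 1 ->
  r0 <= t * b + (d + t * N) * r0 / eta ->
  r1 <= (d + t * N) * r0 / eta ->
  r2 <= (d * r0 + t * N * r1) / eta ->
  b <= N / eta -> (0 < eta -> d <= t * N) ->
  [/\ r0 <= t * b / (1 - (d + t * N) / eta)
      /\ t * b / (1 - (d + t * N) / eta) <= t * (N / eta) / (1 - 2 * t * (N / eta)),
      r1 <= t * (d + t * N) * b / (eta * (1 - (d + t * N) / eta))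
      /\ t * (d + t * N) * b / (eta * (1 - (d + t * N) / eta))
         <= 2 * (t * (N / eta)) ^+ 2 / (1 - 2 * t * (N / eta))
    & r2 <= (d * (t * b / eta)
             + t ^+ 2 * (d * N + t * N ^+ 2) * b / eta ^+ 2)
            * (1 / (1 - 2 * t * N / eta))
      /\ (d * (t * b / eta) + t ^+ 2 * (d * N + t * N ^+ 2) * b / eta ^+ 2)
            * (1 / (1 - 2 * t * N / eta))
         <= (t * (d / eta) * (N / eta) + 2 * (t * (N / eta)) ^+ 3)
            * (1 / (1 - 2 * t * (N / eta)))].
Proof.
move=> t0 b0 d0 N0 eta0 n0 small hr0 hr1 hr2 hb hd.
(* A zero gap occurs for [n = 1]: division by zero gives [0], so [b = 0] and every bound collapses
   to [0]. *)
have [eta_eq|etaN] := eqVneq eta 0.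
  move: hr0 hr1 hr2 hb; rewrite eta_eq expr0n /= !mul0r !invr0 !mulr0 ?addr0.
  move=> hr0 hr1 hr2 hb.
  have b00 : b = 0 by apply/eqP; rewrite eq_le hb b0.
  by move: hr0; rewrite b00 !mulr0 !mul0r !expr0n /= !mulr0 !mul0r addr0 ?mul0r.
have etap : 0 < eta by rewrite lt_def etaN.
have {}hd := hd etap.
(* In these scaled variables [p <= q] and [2 * q < 1], so the denominator [k] is at least
   [1 - 2 * q], which is positive. *)
pose p := d / eta; pose q := t * (N / eta).
pose rho := N / eta; pose k := 1 - (p + q).
have p0 : 0 <= p by rewrite divr_ge0.
have rho0 : 0 <= rho by rewrite divr_ge0.
have q0 : 0 <= q by rewrite mulr_ge0.
have pq : p <= q by rewrite /p /q mulrA ler_wpM2r ?invr_ge0.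
have q2 : 2 * q < 1 by rewrite /q mulrA.
have kp : 0 < k by rewrite /k; lra.
have qk : 1 - 2 * q <= k by rewrite /k; lra.
have kE : 1 - (d + t * N) / eta = k by rewrite /k /p /q; field.
have bk0 : 0 <= t * b / k by rewrite !mulr_ge0 ?invr_ge0 // ltW.
have q2E : 1 - 2 * t * N / eta = 1 - 2 * q by rewrite /q; field.
have kV : k^-1 <= (1 - 2 * q)^-1 by rewrite lef_pV2 ?posrE //; lra.
(* The implicit bound on [r0] is solved by moving its right-hand occurrence to the left and dividing
   by [k]. *)
have hr0k : r0 <= t * b / k.
  rewrite ler_pdivlMr //; rewrite mulrC /k /p /q.
  have -> : (1 - (d / eta + t * (N / eta))) * r0 = r0 - (d + t * N) * r0 / eta by field.
  by rewrite lerBlDr.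
have hr1k : r1 <= (p + q) * (t * b / k).
  apply: le_trans hr1 _.
  have -> : (d + t * N) * r0 / eta = (p + q) * r0 by rewrite /p /q; field.
  by rewrite ler_wpM2l // addr_ge0.
have c2 : t * b / k <= q / (1 - 2 * q).
  apply: ler_pM; rewrite ?invr_ge0 ?mulr_ge0 //; first exact: ltW.
  by rewrite ler_wpM2l.
have e1 : t * (d + t * N) * b / (eta * k) = (p + q) * (t * b / k).
  by rewrite /p /q; field; rewrite etaN gt_eqF.
rewrite kE e1 q2E -!(mulrA 2 t) -/q -/rho -/p; split; split => //.
- have -> : 2 * q ^+ 2 / (1 - 2 * q) = (2 * q) * (q / (1 - 2 * q)) by ring.
  by apply: ler_pM => //; lra.
(* The bound comes out with denominator [k] and is then weakened to [1 - 2 * q]. *)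
- have -> : d * (t * b / eta) + t ^+ 2 * (d * N + t * N ^+ 2) * b / eta ^+ 2
    = (p + q * (p + q)) * (t * b) by rewrite /p /q; field.
  rewrite mul1r -mulrA.
  apply: (@le_trans _ _ ((p + q * (p + q)) * (t * b / k))); last first.
    apply: ler_wpM2l; last by apply: ler_wpM2l; rewrite ?mulr_ge0.
    by apply: addr_ge0 => //; apply: mulr_ge0 => //; apply: addr_ge0.
  apply: le_trans hr2 _.
  have -> : (d * r0 + t * N * r1) / eta = p * r0 + q * r1 by rewrite /p /q; field.
  by rewrite mulrDl -(mulrA q) lerD // ler_wpM2l.
- rewrite ler_wpM2r ?divr_ge0 //; first by lra.
  have -> : d * (t * b / eta) + t ^+ 2 * (d * N + t * N ^+ 2) * b / eta ^+ 2
    = t * p * b + q * (p + q) * (t * b) by rewrite /p /q; field.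
  apply: lerD; first by rewrite ler_wpM2l // mulr_ge0.
  have -> : 2 * q ^+ 3 = q * (2 * q) * q by ring.
  apply: ler_pM; [|exact: mulr_ge0| |exact: ler_wpM2l].
    by apply: mulr_ge0 => //; apply: addr_ge0.
  by apply: ler_wpM2l => //; lra.
Qed.

Theorem theorem3p8 (R : realType) (n : nat) (D E B : 'M[R[i]]_n)
    (hDdiag : is_diag_mx D)
    (hDdistinct : injective (fun j : 'I_n => D j j))
    (hE : forall j : 'I_n, E j j = 0)
    (hBdiag : forall j : 'I_n, B j j = 0)
    (hEB : E = D *m B - B *m D)
    (i : 'I_n) (t : R) (ht : 0 <= t <= 1) (htrho : 2 * t * rho_gap D E i < 1)
    (lam : R -> R[i]) (hlam : is_perturbed_eigenvalue D E i t lam)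
    (x : R -> 'cV[R[i]]_n)
    (hx : is_normalized_eigenvector (D + t%:C *: E) i (lam t) (x t)) :
  [/\ (enorm (res0 i x t)
         <= t * enorm (col i B)
            / (1 - (cabs (Delta D i lam t) + t * specnorm E) / eta_gap D i))
      /\ (t * enorm (col i B)
            / (1 - (cabs (Delta D i lam t) + t * specnorm E) / eta_gap D i)
         <= t * rho_gap D E i / (1 - 2 * t * rho_gap D E i)),
      (enorm (res1 B i x t)
         <= t * (cabs (Delta D i lam t) + t * specnorm E) * enorm (col i B)
            / (eta_gap D i
               * (1 - (cabs (Delta D i lam t) + t * specnorm E) / eta_gap D i)))
      /\ (t * (cabs (Delta D i lam t) + t * specnorm E) * enorm (col i B)
            / (eta_gap D i
               * (1 - (cabs (Delta D i lam t) + t * specnorm E) / eta_gap D i))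
         <= 2 * (t * rho_gap D E i) ^+ 2 / (1 - 2 * t * rho_gap D E i))
    & (enorm (res2 D E B i x t)
         <= (cabs (Delta D i lam t) * (t * enorm (col i B) / eta_gap D i)
             + t ^+ 2
               * (cabs (Delta D i lam t) * specnorm E + t * specnorm E ^+ 2)
               * enorm (col i B) / eta_gap D i ^+ 2)
            * (1 / (1 - 2 * t * specnorm E / eta_gap D i)))
      /\ ((cabs (Delta D i lam t) * (t * enorm (col i B) / eta_gap D i)
             + t ^+ 2
               * (cabs (Delta D i lam t) * specnorm E + t * specnorm E ^+ 2)
               * enorm (col i B) / eta_gap D i ^+ 2)
            * (1 / (1 - 2 * t * specnorm E / eta_gap D i))
         <= (t * (cabs (Delta D i lam t) / eta_gap D i) * rho_gap D E i
             + 2 * (t * rho_gap D E i) ^+ 3)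
            * (1 / (1 - 2 * t * rho_gap D E i)))].
Proof.
have /andP[t0 t1] := ht.
have hr0 := enorm_res0_le hDdiag hDdistinct hBdiag hEB t0 hx.
have hr1 := enorm_res1_le hDdiag hDdistinct hBdiag hEB t0 hx.
have hr2 := enorm_res2_le hDdiag hDdistinct hBdiag hEB t0 hx.
have hb := enorm_col_commutator hDdiag hDdistinct hBdiag hEB i.
have eta0 := eta_gap_ge0 i hDdistinct.
have N0 := specnorm_ge0 E.
have b0 := enorm_ge0 (col i B).
have d0 := cabs_ge0 (Delta D i lam t).
(* Multiplying [htrho] by a positive gap yields the disjointness condition of [Delta_le]. *)
have hd : 0 < eta_gap D i -> cabs (Delta D i lam t) <= t * specnorm E.
  move=> etap; apply: Delta_le => //.
  by move: htrho; rewrite /rho_gap mulrA ltr_pdivrMr // mul1r -mulrA.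
have n0 := enorm_ge0 (res0 i x t).
exact: (residual_bounds_arith t0 b0 d0 N0 eta0 n0 htrho hr0 hr1 hr2 hb hd).
Qed.
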